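(* There is an absolute constant $C>0$ such that for every power $q$ of an odd prime, \[ \chi(G_{q^2})\le 2q+C\frac{q}{\log q}. \]
   Context: For a power $Q$ of an odd prime, the graph $G_Q$ has vertex set $\mathbb{F}_Q\times\mathbb{F}_Q$, and distinct vertices $(x_1,x_2)$, $(y_1,y_2)$ are adjacent if and only if $(x_1+y_1)^2=x_2+y_2$; $G_Q$ has no loops. $\chi$ denotes the chromatic number. *)

(* Defs.v *)
From HB Require Import structures.
From mathcomp Require Import all_boot all_order all_algebra all_field.
Set Implicit Arguments. Unset Strict Implicit. Unset Printing Implicit Defensive.
Import GRing.Theory.

Definition colorableb (T : finType) (e : rel T) (k : nat) : bool :=
  [exists f : {ffun T -> 'I_k}, [forall x, forall y, e x y ==> (f x != f y)]].

Definition Gadj (F : finFieldType) : rel (F * F)%type :=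
  fun x y => (x != y) && ((x.1 + y.1) ^+ 2 == x.2 + y.2)%R.

Lemma Gadj_colorable (F : finFieldType) :
  exists k, colorableb (@Gadj F) k.
Proof.
exists #|{: F * F}|; apply/existsP; exists [ffun x => enum_rank x].
apply/forallP => x; apply/forallP => y; apply/implyP => /andP [nxy _].
by rewrite !ffunE; apply: contra nxy => /eqP /enum_rank_inj ->.
Qed.

Definition chiG (F : finFieldType) : nat := ex_minn (Gadj_colorable F).

(* Main.v *)
(** Write K for the subfield of order q of F = F_(q^2), and F = K + K th with
    th^2 = d in K.  Writing x_1 = s + t th and x_2 = c + e th, the vertices with
    the same t and with e - 4ts nonzero of a given sign (a choice of one element
    in each pair {b, -b}) are independent, which takes 2q colours.  On the
    remaining q^3 vertices, after the change of variable
    c' = 2 s^2 + 2 d t^2 - c, two vertices can only be adjacent if they agree in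
    s and c'_1 + c'_2 = d (t_1 - t_2)^2, or agree in t and
    c'_1 + c'_2 = (s_1 - s_2)^2.

    Split K into N cells and colour by cell(s) + cell(t) mod N together with a
    class of c', where c' in one class never sum to (s_1 - s_2)^2 or
    d (s_1 - s_2)^2 with s_1, s_2 in one cell; the few c' in no class are
    coloured greedily.  With l about log q and p at most l^6, the cells
    are the cosets of an F_p-subspace W of dimension about log_p l, and c' is
    considered modulo the small subspace W W + d W W.  For p > l^6 the cells are
    arithmetic progressions of length at most l and difference 1, and c' is
    considered through a linear form u mu to F_p, where u is chosen by the
    pigeonhole principle so that u mu(1) and u mu(d) are both close to 0. *)

Require Import Defs.
From HB Require Import structures.
From mathcomp Require Import all_boot all_order all_algebra all_field.
From mathcomp Require Import zify ring.
Set Implicit Arguments. Unset Strict Implicit. Unset Printing Implicit Defensive.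
Import GRing.Theory.
Local Open Scope ring_scope.

(** * Graph colourings and choices of sign *)

Lemma colorableb_fun (T C : finType) (e : rel T) (f : T -> C) :
  (forall x y, e x y -> f x != f y) -> colorableb e #|C|.
Proof.
move=> fP; apply/existsP; exists [ffun x => enum_rank (f x)].
apply/forallP=> x; apply/forallP=> y; apply/implyP=> /fP.
by rewrite !ffunE; apply: contra => /eqP /enum_rank_inj ->.
Qed.

Lemma chiG_le (F : finFieldType) (k : nat) :
  colorableb (@Gadj F) k -> (chiG F <= k)%N.
Proof. by rewrite /chiG; case: ex_minnP => m _; apply. Qed.

Lemma greedy_coloring (T : finType) (e : rel T) (A : {set T}) (D : nat) :
    symmetric e -> irreflexive e ->
    {in A, forall x, #|[set y in A | e x y]| <= D}%N ->
  exists f : T -> 'I_D.+1, {in A &, forall x y, e x y -> f x != f y}.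
Proof.
move=> e_sym e_irr degA.
suff fP (s : seq T) : {subset s <= A} ->
    exists f : T -> 'I_D.+1, {in s &, forall x y, e x y -> f x != f y}.
- have [x|g gP] := fP (enum A); first by rewrite mem_enum.
  by exists g => x y xA yA; apply: gP; rewrite mem_enum.
elim: s => [|x s IHs] sA; first by exists (fun=> ord0).
have [y ys|f fP] := IHs; first by apply: sA; rewrite inE ys orbT.
have xA : x \in A by apply: sA; rewrite mem_head.
have [xs|xs] := boolP (x \in s).
  by exists f => y z; rewrite !inE => /predU1P[->|ys] /predU1P[->|zs]; apply: fP.
pose B := [set f y | y in [set y in A | e x y]].
have /subsetPn[c _ cB] : ~~ ([set: 'I_D.+1] \subset B).
  apply/negP => /subset_leq_card; rewrite cardsT card_ord leqNgt ltnS.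
  by rewrite (leq_trans (leq_imset_card _ _) (degA x xA)).
exists (fun y => if y == x then c else f y).
have cP y : y \in s -> e x y -> c != f y.
  move=> ys exy; apply: contraNneq cB => ->; apply: imset_f.
  by rewrite inE exy sA // inE ys orbT.
move=> y z; rewrite !inE; case: (eqVneq y x) => [->|_] /= ys.
  by case: (eqVneq z x) => [->|_] /= zs; rewrite ?e_irr //; apply: cP.
case: (eqVneq z x) => [->|_] /= zs; last exact: fP.
by rewrite e_sym eq_sym => eyx; apply: cP.
Qed.

(* An arbitrary choice of one element in each pair [x], [- x]. *)
Definition positive (V : finZmodType) (x : V) : bool :=
  (enum_rank x < enum_rank (- x))%N.

Lemma positiveN (V : finZmodType) (x : V) :
  x != - x -> positive (- x) = ~~ positive x.
Proof.
move=> xN; rewrite /positive opprK -leqNgt ltn_neqAle andb_idl //.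
by move=> _; apply: contra xN => /eqP /val_inj /enum_rank_inj {1}<-.
Qed.

(* [cell] maps to [0, N); [cl] is a two-valued class, only relevant outside the
   small exceptional set [Z]. *)
Definition separating (K : finFieldType) (d : K) (N : nat) (cell : K -> nat)
    (Z : {set K}) (cl : K -> bool) : Prop :=
  (forall s, (cell s < N)%N) /\
  forall s t b c, cell s = cell t -> b \notin Z -> c \notin Z -> cl b = cl c ->
    b + c != (s - t) ^+ 2 /\ b + c != d * (s - t) ^+ 2.

(** * Coordinates over the quadratic extension, and the colouring *)

Section QuadraticExtension.

Variables (F K : finFieldType) (f : {rmorphism K -> F}) (th : F) (d : K).
Variables (re im : F -> K).
Hypothesis nz2 : 2 != 0 :> K.
Hypothesis th2 : th ^+ 2 = f d.
Hypothesis decomp : forall x, x = f (re x) + f (im x) * th.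
Hypothesis re_decomp : forall a b, re (f a + f b * th) = a.
Hypothesis im_decomp : forall a b, im (f a + f b * th) = b.

Let V := (F * F)%type.
Let s (v : V) : K := re v.1.
Let t (v : V) : K := im v.1.
Let skew (v : V) : K := im v.2 - 4 * (t v * s v).
Let defect (v : V) : K := 2 * s v ^+ 2 + 2 * (d * t v ^+ 2) - re v.2.

Lemma Gadj_coords (x y : V) : Gadj x y ->
  (s x + s y) ^+ 2 + d * (t x + t y) ^+ 2 = re x.2 + re y.2 /\
  2 * ((s x + s y) * (t x + t y)) = im x.2 + im y.2.
Proof.
case/andP => _ /eqP.
rewrite (decomp x.1) (decomp y.1) (decomp x.2) (decomp y.2) -/(s x) -/(s y).
rewrite -/(t x) -/(t y) !re_decomp !im_decomp => E.
have {}E : f ((s x + s y) ^+ 2 + d * (t x + t y) ^+ 2) +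
    f (2 * ((s x + s y) * (t x + t y))) * th =
    f (re x.2 + re y.2) + f (im x.2 + im y.2) * th.
  rewrite !rmorphD !rmorphM rmorph_nat !rmorphD /=.
  by rewrite -!th2; apply: etrans (etrans E _); ring.
by split; [have := congr1 re E | have := congr1 im E];
   rewrite ?re_decomp ?im_decomp.
Qed.

(** For a common value $t$, the second coordinate equation makes the [im] parts sum to $4t(s_x +
    s_y)$; this explains the term $4ts$ in [skew]. *)
Lemma Gadj_skew (x y : V) : Gadj x y -> t x = t y -> skew x = - skew y.
Proof.
move=> /Gadj_coords[_ E] tE; apply/eqP; rewrite -addr_eq0; apply/eqP.
have -> : skew x + skew y = im x.2 + im y.2 - 4 * (t x * s x + t y * s y).
  by rewrite /skew; ring.
by rewrite -E tE; ring.
Qed.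

(** With zero skews the second equation becomes $2(s_x - s_y)(t_x - t_y) = 0$. The identity $2a^2 +
    2b^2 - (a+b)^2 = (a-b)^2$ turns the first one into differences, which is the purpose of
    [defect]. *)
Lemma Gadj_skew0 (x y : V) : Gadj x y -> skew x = 0 -> skew y = 0 ->
  (s x = s y /\ defect x + defect y = d * (t x - t y) ^+ 2) \/
  (t x = t y /\ defect x + defect y = (s x - s y) ^+ 2).
Proof.
move=> /Gadj_coords[E1 E2] /eqP; rewrite subr_eq0 => /eqP bx.
move=> /eqP; rewrite subr_eq0 => /eqP yb.
have defE : defect x + defect y = (s x - s y) ^+ 2 + d * (t x - t y) ^+ 2.
  have -> : defect x + defect y = 2 * s x ^+ 2 + 2 * (d * t x ^+ 2) +
    2 * s y ^+ 2 + 2 * (d * t y ^+ 2) - (re x.2 + re y.2).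
    by rewrite /defect; ring.
  by rewrite -E1; ring.
have : 2 * ((s x - s y) * (t x - t y)) == 0.
  have -> : 2 * ((s x - s y) * (t x - t y)) =
    im x.2 + im y.2 - 2 * ((s x + s y) * (t x + t y)).
    by rewrite bx yb; ring.
  by rewrite E2 subrr.
rewrite !mulf_eq0 (negbTE nz2) /= !subr_eq0 => /orP[] /eqP E.
  by left; split; rewrite // defE E subrr expr0n /= add0r.
by right; split; rewrite // defE E subrr expr0n /= mulr0 addr0.
Qed.

(** Three palettes: $2|K|$ colours for nonzero skew, $2N$ for zero skew and defect outside [Z], and
    $4|Z| + 1$ for the greedily coloured rest. *)
Lemma chiG_separating (N : nat) (cell : K -> nat) (Z : {set K}) (cl : K -> bool) :
  separating d N cell Z cl ->
  (chiG F <= 2 * #|K| + 2 * N + 4 * #|Z| + 1)%N.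
Proof.
move=> [cellN sepP].
case: N cellN => [|N] cellN; first by have := cellN 0.
have adjC : symmetric (@Gadj F).
  by move=> x y; rewrite /Gadj eq_sym [x.1 + _]addrC [x.2 + _]addrC.
have adjI : irreflexive (@Gadj F) by move=> x; rewrite /Gadj eqxx.
have nzN (a : K) : a != 0 -> a != - a.
  by apply: contraNneq => /eqP; rewrite -addr_eq0 -mulr2n -mulr_natl mulf_eq0
    (negbTE nz2).
have sqr_positive (a b : K) : a ^+ 2 = b ^+ 2 -> positive a = positive b -> a = b.
  move=> /eqP; rewrite eqf_sqr => /orP[/eqP //|/eqP ->].
  by case: (eqVneq b 0) => [->|/nzN/positiveN ->]; rewrite ?oppr0 //; case: positive.
(* If [d] were 0, so would be [th], and [im 0] would be both 0 and 1. *)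
have nzd : d != 0.
  apply: contraTneq isT => d0; have := im_decomp 0 1; have := im_decomp 0 0.
  move: th2; rewrite d0 !rmorph0 => /eqP; rewrite sqrf_eq0 => /eqP ->.
  by rewrite !mulr0 !addr0 => -> /eqP; rewrite eq_sym oner_eq0.
have coords_inj (x y : V) : s x = s y -> t x = t y -> defect x = defect y ->
    skew x = skew y -> x = y.
  rewrite /defect /skew => sE tE; rewrite sE tE => /addrI /oppr_inj rE /addIr iE.
  have E1 : x.1 = y.1.
    by rewrite (decomp x.1) (decomp y.1) -/(s x) -/(t x) sE tE.
  have E2 : x.2 = y.2 by rewrite (decomp x.2) (decomp y.2) rE iE.
  by rewrite [x]surjective_pairing [y]surjective_pairing E1 E2.
pose A := [set v : V | (skew v == 0) && (defect v \in Z)].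
have degA : {in A, forall x, #|[set y in A | Gadj x y]| <= 4 * #|Z|}%N.
  move=> x; rewrite inE => /andP[/eqP xb xZ].
  (* A neighbour of [x] is fixed by its defect and two bits: whether it shares [s] with [x], and the
     sign of the other difference, whose square is known. So degrees are at most $4|Z|$. *)
  pose h y := (defect y, (s x == s y,
    positive (if s x == s y then t x - t y else s x - s y))).
  have h_inj : {in [set y in A | Gadj x y] &, injective h}.
    move=> y z; rewrite !inE => /andP[/andP[/eqP yb yZ] xy].
    move=> /andP[/andP[/eqP zb zZ] xz] [dE sE pE].
    have := Gadj_skew0 xy xb yb; have := Gadj_skew0 xz xb zb.
    move: pE; rewrite -sE dE; case: (eqVneq (s x) (s y)) sE => [sxy|nsxy] sE pE.
      move: sE => /esym/eqP sxz.
      (* When [s x = s w], the second alternative makes both sides 0, so the first equation holds in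
         either case. *)
      have Q w : s x = s w -> (s x = s w /\ defect x + defect z =
           d * (t x - t w) ^+ 2 \/ t x = t w /\ defect x + defect z =
           (s x - s w) ^+ 2) -> d * (t x - t w) ^+ 2 = defect x + defect z.
        by move=> E [[_ ->]//|[-> ->]]; rewrite E !subrr expr0n mulr0.
      move=> /(Q z sxz) Ez /(Q y sxy) Ey.
      apply: coords_inj; rewrite ?yb ?zb -?sxy //; apply/oppr_inj/(addrI (t x)).
      by apply: sqr_positive pE; apply/(mulfI nzd); rewrite Ey.
    have {}sE : s x <> s z by apply/eqP; rewrite -sE.
    move=> [[]//|[txz Ez]] [[/eqP]|[txy Ey]]; first by rewrite (negbTE nsxy).
    apply: coords_inj; rewrite ?yb ?zb -?txy //; apply/oppr_inj/(addrI (s x)).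
    by apply: sqr_positive pE; rewrite -Ey.
  rewrite -(card_in_imset h_inj).
  have -> : (4 * #|Z| = #|setX Z [set: bool * bool]|)%N.
    by rewrite cardsX cardsT card_prod card_bool mulnC.
  apply: subset_leq_card; apply/subsetP => _ /imsetP[y yA ->].
  by rewrite !inE /=; move: yA; rewrite !inE => /andP[/andP[_ ->]].
have [g gP] := greedy_coloring adjC adjI degA.
pose C := ((K * bool) + ('I_N.+1 * bool) + 'I_(4 * #|Z|).+1)%type.
pose col (v : V) : C :=
  if skew v != 0 then inl (inl (t v, positive (skew v)))
  (* The coordinate shared by two adjacent vertices cancels from the sum of cells, so one index
     serves both kinds of edge. *)
  else if defect v \notin Z then
    inl (inr (inord ((cell (s v) + cell (t v)) %% N.+1), cl (defect v)))
  else inr (g v).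
suff colP (x y : V) : Gadj x y -> col x != col y.
  have := chiG_le (colorableb_fun colP); move/leq_trans; apply.
  by rewrite !card_sum !card_prod !card_ord card_bool; move: #|_| #|_| => *; lia.
move=> xy; apply: contraTneq xy; rewrite /col.
case: (eqVneq (skew x) 0) => [x0|nx0]; case: (eqVneq (skew y) 0) => [y0|ny0] //=.
- case: (boolP (defect x \in Z)) => xZ; case: (boolP (defect y \in Z)) => yZ //=.
    case=> gE; apply/negP => xy.
    by have := gP x y; rewrite !inE x0 y0 !eqxx xZ yZ gE eqxx => /(_ isT isT xy).
  case=> /(congr1 (@nat_of_ord _)); rewrite !inordK ?ltn_mod // => E clE.
  apply/negP => /Gadj_skew0 /(_ x0 y0) [] [E1 /eqP E2].
    have cE : cell (t x) = cell (t y).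
      move/eqP: E; rewrite E1 eqn_modDl !modn_small ?cellN // => /eqP //.
    by have [_] := sepP _ _ _ _ cE xZ yZ clE; rewrite E2.
  have cE : cell (s x) = cell (s y).
    move/eqP: E; rewrite E1 eqn_modDr !modn_small ?cellN // => /eqP //.
  by have [] := sepP _ _ _ _ cE xZ yZ clE; rewrite E2.
- by case: ifP.
- by case: ifP.
case=> tE pE; apply/negP => xy; move: pE; rewrite (Gadj_skew xy tE).
by rewrite (positiveN (nzN _ ny0)); case: positive.
Qed.

End QuadraticExtension.

(** * Small characteristic: cosets of a subspace *)

(** Within a cell, $(s-t)^2$ and $d(s-t)^2$ both lie in [U], which is taken as [Z]. Modulo [U],
    opposite nonzero elements get different classes, so $b + c$ stays outside [U]. *)
Lemma separating_small_char (K : finFieldType) (p k w : nat) (d : K) :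
    prime p -> odd p -> #|K| = (p ^ k)%N -> (w <= k)%N ->
  exists (cell : K -> nat) Z cl,
    separating d (p ^ (k - w)) cell Z cl /\ (#|Z| <= p ^ (2 * w ^ 2))%N.
Proof.
move=> p_pr p_odd cardK wk.
have charK := card_finPcharP cardK p_pr.
pose L : falgType 'F_p := pPrimeCharType charK.
have cardV (U : {vspace L}) : #|[set x : K | (x : L) \in U]| = (p ^ \dim U)%N.
  by rewrite cardsE (@card_vspace _ (pPrimeCharType charK) _ U) card_Fp.
have dimL : \dim {: L} = k.
  apply/eqP; rewrite -(eqn_exp2l _ _ (prime_gt1 p_pr)) -cardV -cardK.
  by apply/eqP/eq_card => x; rewrite !inE memvf.
have nzN (a : K) : a != 0 -> a != - a.
  apply: contraNneq => /eqP; rewrite -addr_eq0 -mulr2n -mulr_natl mulf_eq0.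
  rewrite -(dvdn_pcharf charK) => /orP[|//].
  by rewrite dvdn_prime2 // => /eqP p2; rewrite p2 in p_odd.
(* This map has kernel [U], so its values serve as representatives of the cosets of [U]. *)
pose quo (U : {vspace L}) : 'End(L) := (\1 - projv U)%VF.
have kerQ (U : {vspace L}) x y : quo U x = quo U y -> x - y \in U.
  rewrite /quo !lfun_simp => E.
  have -> : x - y = projv U x - projv U y.
    by apply/eqP; rewrite subr_eq -addrA addrC -subr_eq E addrC.
  by rewrite rpredB ?memv_proj.
have quo0 (U : {vspace L}) x : x \in U -> quo U x = 0.
  by move=> xU; rewrite /quo !lfun_simp projv_id ?subrr.
have dimQ (U : {vspace L}) : \dim (limg (quo U)) = (k - \dim U)%N.
  have kerE : lker (quo U) = U.
    apply/vspaceP => x; rewrite memv_ker; apply/eqP/idP => [|/quo0 //].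
    by rewrite -(linear0 (quo U)) => /kerQ; rewrite subr0.
  by have := limg_ker_dim (quo U) fullv; rewrite capfv kerE dimL => <-; rewrite addKn.
pose W : {vspace L} := <<take w (vbasis {:L})>>%VS.
have dimW : \dim W = w.
  have /eqP -> : free (take w (vbasis {:L})).
    by move: (basis_free (vbasisP {:L})); rewrite -{1}(cat_take_drop w (vbasis _));
      apply: catl_free.
  by rewrite size_takel // size_tuple dimL.
pose U := (W * W + <[d : L]> * (W * W))%VS.
have dimU : (\dim U <= 2 * w ^ 2)%N.
  have WW : (\dim (W * W)%VS <= w ^ 2)%N.
    by rewrite (leq_trans (dim_prodv _ _)) // dimW.
  rewrite (leq_trans (dimv_add_leqif _ _)) // mul2n -addnn leq_add //.
  rewrite (leq_trans (dim_prodv _ _)) // dim_vline.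
  by case: eqVneq => _; rewrite ?mul0n ?mul1n.
pose S := [set x : K | (x : L) \in limg (quo W)].
have cardS : #|S| = (p ^ (k - w))%N by rewrite cardV dimQ dimW.
have inS x : (quo W x : K) \in S by rewrite inE memv_img ?memvf.
exists (fun x => index (quo W x : K) (enum S)), [set x : K | (x : L) \in U],
  (fun x => positive (quo U x : K)).
split; last by rewrite cardV leq_exp2l ?prime_gt1.
split=> [x|s t b c E]; first by rewrite -cardS cardE index_mem mem_enum.
rewrite !inE => bU cU clE.
have /kerQ stW : quo W s = quo W t.
  have := congr1 (nth (0 : K) (enum S)) E; rewrite !nth_index ?mem_enum //.
have bcU : (b + c : L) \notin U.
  apply/negP => bcU.
  have bcE : quo U b = - quo U c.
    by have /eqP := quo0 U _ bcU; rewrite linearD addr_eq0 => /eqP.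
  have nz : (quo U c : K) != 0.
    by apply: contraNneq cU => c0; rewrite -[c]subr0 kerQ // linear0.
  by move: clE; rewrite bcE (positiveN (nzN _ nz)); case: positive.
have stWW : ((s - t) ^+ 2 : L) \in (W * W)%VS by rewrite expr2 memv_mul.
split; apply: contraNneq bcU => ->.
  by rewrite (subvP (addvSl _ _)).
by rewrite (subvP (addvSr _ _)) // memv_mul ?memv_line.
Qed.

(** * Large characteristic: arithmetic progressions and a linear form *)

Definition nearzero (p M : nat) : {set 'F_p} :=
  [set (n : nat)%:R | n : 'I_M.+1] :|: [set - (n : nat)%:R | n : 'I_M.+1].

Lemma nearzeroP (p M : nat) (x : 'F_p) :
  reflect (exists2 n : nat, (n <= M)%N & x = n%:R \/ x = - n%:R)
          (x \in nearzero p M).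
Proof.
apply: (iffP setUP) => [[/imsetP[n _ ->]|/imsetP[n _ ->]]|[n nM [->|->]]].
- by exists n; [rewrite -ltnS|left].
- by exists n; [rewrite -ltnS|right].
- by left; apply/imsetP; exists (Ordinal (nM : (n < M.+1)%N)).
- by right; apply/imsetP; exists (Ordinal (nM : (n < M.+1)%N)).
Qed.

Lemma card_nearzero (p M : nat) : (#|nearzero p M| <= 2 * M.+1)%N.
Proof.
rewrite (leq_trans (leq_card_setU _ _)) // mul2n -addnn.
by apply: leq_add; rewrite (leq_trans (leq_imset_card _ _)) // card_ord.
Qed.

Lemma nearzeroM (p M n : nat) (x : 'F_p) :
  x \in nearzero p M -> n%:R * x \in nearzero p (M * n).
Proof.
case/nearzeroP => m mM xE; apply/nearzeroP; exists (n * m)%N.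
  by rewrite mulnC leq_mul2r mM orbT.
by rewrite natrM; case: xE => ->; [left|right; rewrite mulrN].
Qed.

Lemma leq_nearzero (p M M' : nat) : (M <= M')%N ->
  nearzero p M \subset nearzero p M'.
Proof.
move=> MM'; apply/subsetP => x /nearzeroP[n nM xE].
by apply/nearzeroP; exists n => //; apply: leq_trans MM'.
Qed.

Lemma Fp_natr_val (p : nat) (x : 'F_p) : prime p -> (x : nat)%:R = x.
Proof. by move=> p_pr; exact: natr_Zp. Qed.

Lemma Fp_ltn (p : nat) (x : 'F_p) : prime p -> (x < p)%N.
Proof. by move=> p_pr; rewrite -[leqRHS](Fp_cast p_pr). Qed.

(* If the representatives of [x] and [y] in [0, p) lie in the same half, that of
   [x + y] is the average of those of [x *+ 2] and [y *+ 2]. *)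
Lemma addr_nearzero (p M : nat) (x y : 'F_p) : prime p ->
    x *+ 2 \notin nearzero p M -> y *+ 2 \notin nearzero p M ->
    (2 * x < p)%N = (2 * y < p)%N ->
  x + y \notin nearzero p M.
Proof.
move=> p_pr; have p0 : p%:R = 0 :> 'F_p by rewrite pchar_Fp_0.
have pdvd n : (n%:R == 0 :> 'F_p) = (p %| n)%N.
  by rewrite -(dvdn_pcharf (pchar_Fp p_pr)).
(* As [c] is 0 modulo [p], [2 * z - c] is the representative of [z *+ 2] in $[0, p)$; it must lie
   strictly between $M$ and $p - M$. *)
have far (z : 'F_p) (c : nat) : z *+ 2 \notin nearzero p M -> c%:R = 0 :> 'F_p ->
    (c <= 2 * z < p + c)%N -> (M < 2 * z - c)%N /\ (2 * z - c + M < p)%N.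
  move=> zM c0 /andP[cz zc].
  have zE : (2 * z - c)%:R = z *+ 2.
    by rewrite natrB // c0 subr0 natrM Fp_natr_val // mulr_natl.
  split; rewrite ltnNge; apply: contra zM => zM; apply/nearzeroP.
    by exists (2 * z - c)%N; [|left].
  exists (p - (2 * z - c))%N; first by lia.
  by right; rewrite natrB ?p0 ?sub0r ?opprK ?zE //; lia.
move=> xM yM xy.
(* [c] is 0 for the lower half and [p] for the upper one. *)
have [c [c0 cx cy]] : exists c : nat, [/\ c%:R = 0 :> 'F_p,
    (c <= 2 * x < p + c)%N & (c <= 2 * y < p + c)%N].
  have := Fp_ltn x p_pr; have := Fp_ltn y p_pr; case: (ltnP (2 * x) p) xy => xp yp.
    by exists 0%N; split; rewrite //; lia.
  by exists p; split; rewrite //; lia.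
have [Mx xp] := far x c xM c0 cx; have [My yp] := far y c yM c0 cy.
have xyE : (x + y - c)%:R = x + y :> 'F_p.
  by rewrite natrB ?c0 ?subr0 ?natrD ?Fp_natr_val //; lia.
apply/nearzeroP => -[n nM]; rewrite -xyE => -[/eqP|/eqP]; last first.
  rewrite -addr_eq0 -natrD pdvd => /dvdn_leq; lia.
rewrite -subr_eq0 -natrB ?pdvd; last by lia.
by move=> /dvdn_leq; lia.
Qed.

(** Dirichlet's argument: the $p$ pairs $(x, xb)$ fall into $B^2 < p$ boxes, and two pairs in one
    box differ by $(u, ub)$. *)
Lemma simultaneous_approximation (p B : nat) (b : 'F_p) :
    prime p -> (B ^ 2 < p)%N -> (0 < B)%N ->
  exists u : 'F_p, [/\ u != 0, u \in nearzero p (p %/ B) & u * b \in nearzero p (p %/ B)].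
Proof.
move=> p_pr Bp; have p_gt0 := prime_gt0 p_pr.
case: B Bp => [|B] // Bp _.
(* [B.+1] blocks of this length cover $[0, p)$, and two members of one block differ by at most
   [p %/ B.+1]. *)
pose h := (p %/ B.+1).+1.
have box (x : 'F_p) : (x %/ h < B.+1)%N.
  rewrite ltn_divLR // (leq_trans (Fp_ltn x p_pr)) //.
  by rewrite mulnC ltnW // ltn_ceil.
have near (x y : 'F_p) : (x %/ h = y %/ h)%N -> x - y \in nearzero p (p %/ B.+1).
  move=> E; apply/nearzeroP.
  have := divn_eq x h; have := divn_eq y h; have := ltn_pmod x (ltn0Sn _ : 0 < h)%N.
  have := ltn_pmod y (ltn0Sn _ : 0 < h)%N; rewrite E.
  move: (y %/ h * h)%N (x %% h)%N (y %% h)%N => a r s; rewrite /h => sh rh yE xE.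
  rewrite -[x]Fp_natr_val // -[y]Fp_natr_val // yE xE.
  case: (leqP s r) => rs.
    by exists (r - s)%N; [lia|left; rewrite natrB // !natrD; ring].
  by exists (s - r)%N; [lia|right; rewrite natrB ?(ltnW rs) // !natrD; ring].
pose g (x : 'F_p) := (Ordinal (box x), Ordinal (box (x * b))).
have /injectivePn[x [y xy gxy]] : ~~ injectiveb g.
  apply/negP => /injectiveP/leq_card; rewrite card_Fp // card_prod !card_ord.
  by rewrite leqNgt mulnn Bp.
case: gxy => E1 E2; exists (x - y); rewrite subr_eq0 xy; split=> //.
  exact: near.
by rewrite mulrBl; apply: near.
Qed.

(** Some coordinate form in a basis is nonzero at 1; dividing by its value there normalises it. *)
Lemma Fp_functional (K : finFieldType) (p k : nat) : prime p -> #|K| = (p ^ k)%N ->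
  exists mu : K -> 'F_p, [/\ forall x y, mu (x - y) = mu x - mu y,
    forall x n, mu (x *+ n) = mu x *+ n & mu 1 = 1].
Proof.
move=> p_pr cardK; have charK := card_finPcharP cardK p_pr.
pose L : falgType 'F_p := pPrimeCharType charK.
pose X := vbasis {:L}.
have [i nzi] : exists i, coord X i (1 : L) != 0.
  apply/existsP; apply: contraT; rewrite negb_exists => /forallP all0.
  have := coord_vbasis (memvf (1 : L)); rewrite big1 => [/eqP|i _].
    by rewrite oner_eq0.
  by move: (all0 i); rewrite negbK => /eqP ->; rewrite scale0r.
exists (fun x => coord X i (x : L) / coord X i (1 : L)).
split=> [x y|x n|]; last by rewrite divff.
  by rewrite -mulrBl -raddfB.
by rewrite -mulrnAl -raddfMn.
Qed.

Lemma sqr_natrB_divn (R : comNzRingType) (m n l : nat) :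
    (0 < l)%N -> (m %/ l = n %/ l)%N ->
  exists2 j : nat, (j < l)%N & (m%:R - n%:R) ^+ 2 = (j ^ 2)%:R :> R.
Proof.
move=> l_gt0 E; rewrite (divn_eq m l) (divn_eq n l) E.
have := ltn_pmod m l_gt0; have := ltn_pmod n l_gt0.
move: (m %% l)%N (n %% l)%N => r s sl rl; rewrite !natrD [X in X ^+ 2](_ : _ = r%:R - s%:R); last by ring.
case: (leqP s r) => rs.
  by exists (r - s)%N; rewrite ?natrX ?natrB // (leq_ltn_trans (leq_subr _ _)).
exists (s - r)%N; first by rewrite (leq_ltn_trans (leq_subr _ _)).
by rewrite natrX natrB ?(ltnW rs) // -sqrrN opprB.
Qed.

(** Within a cell, $s - t$ is an integer $\pm j$ with $j < l$, so [u * mu] sends $j^2$ and $d j^2$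
    close to 0, while [addr_nearzero] keeps [u * mu (b + c)] away from 0. *)
Lemma separating_large_char (K : finFieldType) (p k B l : nat) (d : K) :
    prime p -> odd p -> #|K| = (p ^ k)%N -> (B ^ 2 < p)%N -> (0 < B)%N ->
    (0 < l)%N -> (0 < k)%N ->
  exists (cell : K -> nat) Z cl,
    separating d (p ^ k.-1 * (p %/ l).+1) cell Z cl /\
    (#|Z| <= p ^ k.-1 * (2 * (p %/ B * l ^ 2).+1))%N.
Proof.
move=> p_pr p_odd cardK Bp B_gt0 l_gt0 k_gt0; have p_gt0 := prime_gt0 p_pr.
have charK := card_finPcharP cardK p_pr.
have [mu [muB muMn mu1]] := Fp_functional p_pr cardK.
have muD x y : mu (x + y) = mu x + mu y.
  by rewrite -{1}[y]opprK -[- y]sub0r muB muB -[0](subrr 1) muB subrr sub0r opprK.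
have [u [nzu u_near ud_near]] := simultaneous_approximation (mu d) p_pr Bp B_gt0.
have muE x n : mu ((n%:R : K) * x) = n%:R * mu x.
  by rewrite !mulr_natl muMn.
(* Since [mu 1 = 1], [e] is the projection of $K = \ker \mu \oplus F_p$ onto the kernel. *)
pose e (x : K) : K := x - (mu x : nat)%:R.
have mue x : mu (e x) = 0.
  by rewrite /e muB -[_%:R]mulr1 muE mu1 mulr1 Fp_natr_val // subrr.
pose ker := [set x | mu x == 0].
have e_ker x : e x \in ker by rewrite inE mue.
have cardker : (#|ker| <= p ^ k.-1)%N.
  rewrite -(leq_pmul2r p_gt0) -expnSr prednK // -cardK.
  pose h (z : K * 'F_p) := z.1 + (z.2 : nat)%:R.
  have muh z : z.1 \in ker -> mu (h z) = z.2.
    by rewrite inE => /eqP z0; rewrite muD z0 add0r -[_%:R]mulr1 muE mu1 mulr1 Fp_natr_val.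
  have h_inj : {in setX ker [set: 'F_p] &, injective h}.
    move=> z z'; rewrite !inE !andbT => zk zk' hE.
    have E2 : z.2 = z'.2 by rewrite -muh ?inE // -[RHS]muh ?inE // hE.
    have E1 : z.1 = z'.1 by move: hE; rewrite /h E2 => /addIr.
    by rewrite [z]surjective_pairing [z']surjective_pairing E1 E2.
  have := max_card [in h @: setX ker [set: 'F_p]].
  by rewrite card_in_imset // cardsX cardsT card_Fp.
(* Two digits in base [(p %/ l).+1]: the translate of $F_p$ containing [x], then the block of length
   [l] inside it. *)
pose cell x := (index (e x) (enum ker) * (p %/ l).+1 + mu x %/ l)%N.
have mul_lt x : (mu x %/ l < (p %/ l).+1)%N.
  by rewrite ltnS leq_div2r // ltnW ?Fp_ltn.
pose M := (p %/ B * l ^ 2)%N.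
(* The doubling matches [addr_nearzero]. As 2 and [u] are invertible, [e x] and the doubled value
   still determine [x], which bounds [Z]. *)
pose Z := [set x : K | (u * mu x) *+ 2 \in nearzero p M].
exists cell, Z, (fun x => 2 * (u * mu x)%R < p)%N; split; last first.
  pose h x := (e x, (u * mu x) *+ 2).
  have h_inj : injective h.
    move=> x y hE; have E2 := congr1 snd hE; have := congr1 fst hE.
    rewrite /= /e.
    have -> : mu x = mu y; last by move=> /addIr.
    apply: (mulfI nzu); apply: (@mulfI 'F_p 2%:R).
      rewrite -(dvdn_pcharf (pchar_Fp p_pr)) dvdn_prime2 //.
      by apply: contraTneq p_odd => ->.
    by rewrite (mulr_natl (u * mu x)) (mulr_natl (u * mu y)).
  rewrite -(card_imset _ h_inj).
  apply: leq_trans (_ : #|setX ker (nearzero p M)| <= _)%N.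
    apply/subset_leq_card/subsetP => _ /imsetP[x xZ ->].
    by move: xZ; rewrite !inE mue eqxx.
  by rewrite cardsX leq_mul // card_nearzero.
split=> [x|s t b c E].
  have ex : (index (e x) (enum ker) < #|ker|)%N by rewrite cardE index_mem mem_enum.
  rewrite (@leq_trans (#|ker| * (p %/ l).+1)%N) //; last by rewrite leq_mul2r cardker.
  apply: (@leq_trans ((index (e x) (enum ker)).+1 * (p %/ l).+1)%N).
    by rewrite /cell mulSn addnC ltn_add2r.
  by rewrite leq_mul2r ex orbT.
have [eE lE] : e s = e t /\ (mu s %/ l = mu t %/ l)%N.
  move: E; rewrite /cell => E.
  have := congr1 (divn^~ (p %/ l).+1) E; have := congr1 (modn^~ (p %/ l).+1) E.
  rewrite /= !modnMDl !(modn_small (mul_lt _)) !divnMDl //.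
  rewrite !(divn_small (mul_lt _)) !addn0 => -> iE.
  by have := congr1 (nth 0 (enum ker)) iE; rewrite !nth_index ?mem_enum.
rewrite [b \in Z]inE [c \in Z]inE => bZ cZ clE.
have := addr_nearzero p_pr bZ cZ clE; rewrite -mulrDr -muD => bcM.
have [j jl stE] : exists2 j : nat, (j < l)%N & (s - t) ^+ 2 = (j ^ 2)%:R.
  have -> : s - t = (mu s : nat)%:R - (mu t : nat)%:R.
    by rewrite -{1}[s](subrK (mu s : nat)%:R) [s - _]eE /e; ring.
  exact: sqr_natrB_divn.
have small x : u * mu x \in nearzero p (p %/ B) -> u * mu ((j ^ 2)%:R * x) \in nearzero p M.
  move=> xs; rewrite muE mulrCA; apply: subsetP (nearzeroM (j ^ 2) xs).
  by apply: leq_nearzero; rewrite leq_mul2l leq_exp2r // ltnW ?orbT.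
rewrite stE; split; apply: contraNneq bcM => ->.
  by have := small 1; rewrite mu1 !mulr1; apply.
by rewrite [d * _]mulrC; apply: small.
Qed.

(** * The subfield of order $q$ as a fixed field *)

Section SubfieldType.

Variables (F : finFieldType) (S : divringClosed F).

(** A type of its own lets the subfield be a [finFieldType], with the inclusion [val] as a ring
    morphism. *)
Inductive subfield_type : predArgType := SubfieldElt x of x \in S.
Definition subfield_val (u : subfield_type) : F := let: SubfieldElt x _ := u in x.

HB.instance Definition _ := [isSub for subfield_val].
HB.instance Definition _ := [Finite of subfield_type by <:].
HB.instance Definition _ := [SubChoice_isSubComUnitRing of subfield_type by <:].
HB.instance Definition _ :=
  [SubComUnitRing_isSubIntegralDomain of subfield_type by <:].
HB.instance Definition _ := [SubIntegralDomain_isSubField of subfield_type by <:].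

End SubfieldType.

(** As $|F| = q^2$, the map $x \mapsto x^q$ is an involutive automorphism. [K] is its fixed field,
    [th] is anti-invariant, and [re], [im] come from the even and odd parts of an element. *)
Lemma quadratic_subfield (F : finFieldType) (p k : nat) :
    prime p -> odd p -> (0 < k)%N -> #|F| = (p ^ k * p ^ k)%N ->
  exists (K : finFieldType) (f : {rmorphism K -> F}) (th : F) (d : K)
         (re im : F -> K),
  [/\ #|K| = (p ^ k)%N, 2 != 0 :> K & th ^+ 2 = f d] /\
  [/\ forall x, x = f (re x) + f (im x) * th,
      forall a b, re (f a + f b * th) = a & forall a b, im (f a + f b * th) = b].
Proof.
move=> p_pr p_odd k_gt0 cardF; set q := (p ^ k)%N in cardF *.
have charF : p \in [pchar F] by apply: (@card_finPcharP _ _ (k + k)); rewrite ?expnD.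
have nz2F : 2 != 0 :> F.
  by rewrite -(dvdn_pcharf charF) dvdn_prime2 //; apply: contraTneq p_odd => ->.
have q_gt1 : (1 < q)%N by rewrite -(expn0 p) ltn_exp2l ?prime_gt1.
have q_nat : [pchar F].-nat q.
  by rewrite (eq_pnat _ (pcharf_eq charF)) pnatX pnat_id.
pose phi (x : F) := x ^+ q.
have phiD x y : phi (x + y) = phi x + phi y by apply: exprDn_pchar.
have phiM x y : phi (x * y) = phi x * phi y by apply: exprMn.
have phiV x : phi x^-1 = (phi x)^-1 by apply: exprVn.
have phi1 : phi 1 = 1 by apply: expr1n.
have phi0 : phi 0 = 0 by rewrite /phi expr0n gtn_eqF // ltnW.
have phiN x : phi (- x) = - phi x.
  by apply/eqP; rewrite -addr_eq0 -phiD addrC subrr phi0.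
have phiK x : phi (phi x) = x by rewrite /phi -exprM -cardF expf_card.
have phi2 : phi 2 = 2 by rewrite -[2]/(1 + 1) phiD phi1.
(* Otherwise $X^q - X$ would have $q^2$ roots. *)
have [z nz_z] : exists z, phi z != z.
  apply/existsP; apply: contraT; rewrite negb_exists => /forallP fixF.
  have szP : size ('X^q - 'X : {poly F}) = q.+1.
    by rewrite size_polyDl size_polyXn // size_polyN size_polyX ltnS.
  have /max_poly_roots : 'X^q - 'X != 0 :> {poly F} by rewrite -size_poly_eq0 szP.
  move=> /(_ (enum F)); rewrite enum_uniq -cardE cardF szP => roots.
  suff : (q * q < q.+1)%N by rewrite ltnS leqNgt ltn_Pmulr // ltnW.
  apply: roots => //; apply/allP => x _; move/(_ x): fixF; rewrite negbK => /eqP E.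
  by rewrite /root !hornerE -/(phi x) E subrr.
pose th := z - phi z.
have phith : phi th = - th by rewrite phiD phiN phiK opprB addrC.
have nzth : th != 0 by rewrite subr_eq0 eq_sym.
pose S0 : {pred F} := [pred x | phi x == x].
have S0P : divring_closed S0.
  split=> [|x y|x y]; rewrite !inE ?phi1 // => /eqP xE /eqP yE.
    by rewrite phiD phiN xE yE.
  by rewrite phiM phiV xE yE.
pose S0_closed := GRing.isDivringClosed.Build F S0 S0P.
pose S : divringClosed F := HB.pack S0 S0_closed.
pose K : finFieldType := subfield_type S.
pose f : {rmorphism K -> F} := val.
have phif (a : K) : phi (f a) = f a by apply/eqP; exact: (valP a).
have inK x : phi x = x -> exists a : K, f a = x.
  move=> xE; have xS : x \in S by rewrite inE xE.
  by exists (SubfieldElt xS).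
have [re reE] : exists re : F -> K, forall x, f (re x) = (x + phi x) / 2.
  apply: (@fin_all_exists F (fun=> K) (fun x a => f a = (x + phi x) / 2)) => x.
  by apply: inK; rewrite phiM phiV phiD phiK phi2 addrC.
have [im imE] : exists im : F -> K, forall x, f (im x) = (x - phi x) / (2 * th).
  apply: (@fin_all_exists F (fun=> K) (fun x a => f a = (x - phi x) / (2 * th))) => x.
  apply: inK.
  rewrite phiM phiV phiD phiN phiK phiM phi2 phith mulrN invrN mulrN -mulNr.
  by rewrite opprB.
have [d dE] : exists d : K, f d = th ^+ 2.
  by apply: inK; rewrite expr2 phiM phith mulrNN.
have decomp x : x = f (re x) + f (im x) * th.
  by rewrite reE imE; field; rewrite nz2F nzth.
have phi_dec (a b : K) : phi (f a + f b * th) = f a - f b * th.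
  by rewrite phiD phiM !phif phith mulrN.
have re_dec a b : re (f a + f b * th) = a.
  by apply/(fmorph_inj f); rewrite reE phi_dec; field.
have im_dec a b : im (f a + f b * th) = b.
  by apply/(fmorph_inj f); rewrite imE phi_dec; field; rewrite nz2F nzth.
exists K, f, th, d, re, im; split; last by split.
split; last by rewrite dE.
  2: by apply: contraNneq nz2F => /(congr1 f); rewrite rmorph_nat rmorph0 => ->.
(* The coordinates identify $F$ with $K \times K$, whence $|K|^2 = q^2$. *)
pose g x := (re x, im x).
have /bij_eq_card : bijective g.
  exists (fun ab => f ab.1 + f ab.2 * th) => [x|[a b]]; first by rewrite -decomp.
  by rewrite /g re_dec im_dec.
by rewrite card_prod cardF => /eqP; rewrite eqn_sqr => /eqP.
Qed.

(** * Choice of parameters *)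

Lemma chiG_quadratic (F : finFieldType) (p k : nat) :
    prime p -> odd p -> (0 < k)%N -> #|F| = (p ^ k * p ^ k)%N ->
  exists (K : finFieldType) (d : K), #|K| = (p ^ k)%N /\
    forall N cell Z cl, separating d N cell Z cl ->
      (chiG F <= 2 * p ^ k + 2 * N + 4 * #|Z| + 1)%N.
Proof.
move=> p_pr p_odd k_gt0 cardF.
have [K [f [th [d [re [im [[cardK nz2 thE] [dec reE imE]]]]]]]] :=
  quadratic_subfield p_pr p_odd k_gt0 cardF.
exists K, d; split=> // N cell Z cl; rewrite -cardK.
exact: (chiG_separating nz2 thE dec reE imE).
Qed.

(** The choice $B = l^3$ makes [p %/ B * l ^ 2] at most $p/l$. With $q = p^k$ and $l \le p$, the
    terms $2N$, $4|Z|$ and 1 are at most $4q/l$, $16q/l$ and $q/l$, which add up to $21q/l$. *)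
Lemma chiG_large_char (F : finFieldType) (p k l : nat) :
    prime p -> odd p -> (0 < k)%N -> #|F| = (p ^ k * p ^ k)%N ->
    (0 < l)%N -> (l ^ 6 < p)%N ->
  (chiG F * l <= 2 * p ^ k * l + 21 * p ^ k)%N.
Proof.
move=> p_pr p_odd k_gt0 cardF l_gt0 lp.
have [K [d [cardK chiP]]] := chiG_quadratic p_pr p_odd k_gt0 cardF.
have lp3 : ((l ^ 3) ^ 2 < p)%N by rewrite -expnM.
have l3_gt0 : (0 < l ^ 3)%N by rewrite expn_gt0 l_gt0.
have [cell [Z [cl [/chiP chiE cardZ]]]] :=
  separating_large_char d p_pr p_odd cardK lp3 l3_gt0 l_gt0 k_gt0.
have lep : (l <= p)%N.
  by apply: ltnW (leq_ltn_trans _ lp); rewrite -[leqLHS]expn1 leq_pexp2l.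
have pE : (p ^ k = p ^ k.-1 * p)%N by rewrite -expnSr prednK.
have r_gt0 : (0 < p ^ k.-1)%N by rewrite expn_gt0 prime_gt0.
have H1 : (p %/ l * l <= p)%N by apply: leq_divM.
have H2 : (p %/ l ^ 3 * l ^ 2 * l <= p)%N by rewrite -mulnA -expnSr leq_divM.
rewrite pE in chiE *; move: chiE cardZ r_gt0 H1 H2.
move: (p ^ k.-1)%N (p %/ l)%N (p %/ l ^ 3 * l ^ 2)%N (chiG F) #|Z|.
by move=> {chiP cardK cardF pE} r a b c z; nia.
Qed.

(** Each of $N$, $|Z|$ and 1 is at most $q/l$, and $7 = 2 + 4 + 1$. *)
Lemma chiG_small_char (F : finFieldType) (p k l w : nat) :
    prime p -> odd p -> (0 < k)%N -> #|F| = (p ^ k * p ^ k)%N ->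
    (l <= p ^ w)%N -> (p ^ (2 * w ^ 2) * l <= p ^ k)%N -> (0 < l)%N ->
  (chiG F * l <= 2 * p ^ k * l + 7 * p ^ k)%N.
Proof.
move=> p_pr p_odd k_gt0 cardF lw lk l_gt0.
have [K [d [cardK chiP]]] := chiG_quadratic p_pr p_odd k_gt0 cardF.
have p_gt0 := prime_gt0 p_pr.
have wk : (w <= k)%N.
  rewrite -(leq_exp2l _ _ (prime_gt1 p_pr)) (leq_trans _ lk) //.
  apply: (@leq_trans (p ^ (2 * w ^ 2))%N); last by rewrite leq_pmulr.
  by rewrite leq_pexp2l //; nia.
have [cell [Z [cl [/chiP chiE cardZ]]]] :=
  separating_small_char d p_pr p_odd cardK wk.
have H1 : (p ^ (k - w) * l <= p ^ k)%N.
  by rewrite -{2}(subnK wk) expnD leq_mul2l lw orbT.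
have H2 : (#|Z| * l <= p ^ k)%N by rewrite (leq_trans _ lk) // leq_mul2r cardZ orbT.
have H3 : (l <= p ^ k)%N by rewrite (leq_trans _ lk) // leq_pmull // expn_gt0 p_gt0.
move: chiE H1 H2 H3; move: (p ^ k)%N (p ^ (k - w))%N (chiG F) #|Z|.
by move=> {chiP cardK cardF lk cardZ} q a c z; nia.
Qed.

(** At $j = 12$ this reads $2028 \le 2048$; afterwards the right side doubles at each step. *)
Lemma quadratic_leq_exp2 (j : nat) : (11 < j)%N -> (14 * j ^ 2 + j <= 2 ^ j.-1)%N.
Proof.
move=> /subnK <-; elim: (j - 12)%N => [//|i IHi].
have -> : ((i.+1 + 12).-1 = (i + 12).-1.+1)%N by lia.
by rewrite [leqRHS]expnS; apply: leq_trans _ (leq_mul (leqnn 2%N) IHi); rewrite -!mulnn; nia.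
Qed.

(** For $p \le l^6$, let [w] and [j] be the rounded-up logarithms of [l] in bases [p] and 2. Then
    $p^{w-1} < l$ gives $p^w \le l^7 \le 2^{7j}$, so $p^{2w^2} l \le 2^{14j^2+j}$, and $14j^2 + j
    \le 2^{j-1} < l$. *)
Lemma chiG_large (F : finFieldType) (p k l : nat) :
    prime p -> odd p -> (0 < k)%N -> #|F| = (p ^ k * p ^ k)%N ->
    (2 ^ 11 < l)%N -> (2 ^ l.-1 <= p ^ k)%N ->
  (chiG F * l <= 2 * p ^ k * l + 21 * p ^ k)%N.
Proof.
move=> p_pr p_odd k_gt0 cardF l_gt lk.
have l_gt1 : (1 < l)%N by rewrite (leq_ltn_trans _ l_gt) // expn_gt0.
have [lp|pl] := ltnP (l ^ 6) p; first by apply: chiG_large_char => //; apply: ltnW.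
have p_gt1 := prime_gt1 p_pr; have p_gt0 := prime_gt0 p_pr.
have /andP[wl lw] := up_log_bounds p_gt1 l_gt1.
have /andP[jl lj] := up_log_bounds (isT : 1 < 2)%N l_gt1.
set w := up_log p l in wl lw; set j := up_log 2 l in jl lj.
have w_gt0 : (0 < w)%N by rewrite up_log_gt0 p_gt1.
have j_gt0 : (0 < j)%N by rewrite up_log_gt0.
have wj : (w <= j)%N.
  by apply: up_log_min => //; apply: leq_trans lj _; rewrite leq_exp2r.
have j11 : (11 < j)%N.
  by rewrite -(ltn_exp2l _ _ (isT : 1 < 2)%N); apply: leq_trans lj.
have pw : (p ^ w <= 2 ^ (7 * j))%N.
  rewrite mulnC expnM (@leq_trans (l ^ 7)) ?leq_exp2r //.
  rewrite -(prednK w_gt0) expnSr [(l ^ 7)%N]expnS.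
  by rewrite leq_mul // ltnW.
have pw2 : (p ^ (2 * w ^ 2) * l <= p ^ k)%N.
  apply: leq_trans lk; apply: (@leq_trans (2 ^ (14 * j ^ 2 + j))%N).
    rewrite expnD leq_mul // (_ : 2 * w ^ 2 = w * (2 * w))%N; last first.
      by rewrite -mulnn; ring.
    rewrite expnM (@leq_trans ((2 ^ (7 * j)) ^ (2 * w))%N) //.
      by rewrite leq_exp2r // muln_gt0 w_gt0.
    by rewrite -expnM leq_exp2l // -mulnn; nia.
  rewrite leq_exp2l // (leq_trans (quadratic_leq_exp2 j11)) //.
  by rewrite -ltnS prednK // ltnW.
apply: leq_trans (chiG_small_char p_pr p_odd k_gt0 cardF lw pw2 (ltnW l_gt1)) _.
by rewrite leq_add2l leq_mul2r orbT.
Qed.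

(** One colour per vertex costs $q^4 \le 8^l q$, which a constant absorbs while [l] is bounded. *)
Lemma chiG_trivial (F : finFieldType) (q l : nat) : #|F| = (q * q)%N ->
  (q <= 2 ^ l)%N -> (chiG F * l <= 2 * q * l + 2 ^ l * 2 ^ l * 2 ^ l * l * q)%N.
Proof.
move=> cardF ql.
have chi_le : (chiG F <= q * q * (q * q))%N.
  by rewrite -cardF -card_prod; apply/chiG_le/(colorableb_fun (f := id)) => x y /andP[].
apply: leq_trans (leq_addl _ _); rewrite [leqRHS]mulnAC leq_mul2r; apply/orP; right.
by rewrite (leq_trans chi_le) // mulnA !leq_mul.
Qed.

(** Denominators are cleared; [l] will be the number of binary digits of $q$, standing in for the
    logarithm. *)
Lemma chiG_nat : exists C : nat, forall (p k : nat) (F : finFieldType),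
  prime p -> odd p -> (0 < k)%N -> #|F| = (p ^ k * p ^ k)%N ->
  exists2 l : nat, (p ^ k < 2 ^ l)%N &
    (chiG F * l <= 2 * p ^ k * l + C * p ^ k)%N.
Proof.
(* The threshold is hidden so that the powers [2 ^ l0] in the constant stay symbolic. *)
have [l0 large] : exists l0, forall (F : finFieldType) (p k l : nat),
    prime p -> odd p -> (0 < k)%N -> #|F| = (p ^ k * p ^ k)%N ->
    (l0 < l)%N -> (2 ^ l.-1 <= p ^ k)%N ->
    (chiG F * l <= 2 * p ^ k * l + 21 * p ^ k)%N.
  by exists (2 ^ 11)%N => *; apply: chiG_large.
exists (2 ^ l0 * 2 ^ l0 * 2 ^ l0 * l0 + 21)%N => p k F p_pr p_odd k_gt0 cardF.
have /andP[lk kl] : (2 ^ trunc_log 2 (p ^ k) <= p ^ k < 2 ^ (trunc_log 2 (p ^ k)).+1)%N.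
  by apply: trunc_log_bounds; rewrite ?expn_gt0 ?prime_gt0.
exists (trunc_log 2 (p ^ k)).+1 => //; set l := (trunc_log 2 (p ^ k)).+1 in kl *.
have [l0l|ll0] := ltnP l0 l.
  apply: leq_trans (large F p k l p_pr p_odd k_gt0 cardF l0l lk) _.
  by rewrite leq_add2l leq_mul2r leq_addl orbT.
apply: leq_trans (chiG_trivial cardF (ltnW kl)) _; rewrite leq_add2l leq_mul2r.
rewrite (leq_trans _ (leq_addr _ _)) ?orbT //.
by rewrite !leq_mul // leq_exp2l.
Qed.

(* Passage to the real logarithm *)
From Stdlib Require Import Reals Lra.
Open Scope R_scope.

Lemma INR_exp2_le (l : nat) : INR (expn 2 l) <= exp (INR l).
Proof.
elim: l => [|l IHl]; first by rewrite exp_0; apply: Rle_refl.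
rewrite expnS -multE mult_INR (S_INR l) exp_plus Rmult_comm.
apply: Rmult_le_compat => //; try exact: pos_INR.
by have := exp_ineq1 1 R1_neq_R0; rewrite /=; lra.
Qed.

Theorem theorem3p3 :
  exists C : R, 0 < C /\
    forall (p k : nat), prime p -> odd p -> leq 1 k ->
    forall F : finFieldType, #|F| = muln (expn p k) (expn p k) ->
      INR (chiG F) <=
        2 * INR (expn p k) + C * INR (expn p k) / ln (INR (expn p k)).
Proof.
have [C chiP] := chiG_nat.
(* Adding 1 keeps the constant positive even if [C] is 0. *)
exists (INR C + 1); split=> [|p k p_pr p_odd k_gt0 F cardF].
  by have := pos_INR C; lra.
have [l /ltP/lt_INR ql chi_le] := chiP p k F p_pr p_odd k_gt0 cardF.
have q_gt1 : 1 < INR (expn p k).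
  rewrite -[1]/(INR 1); apply/lt_INR/ltP.
  by rewrite -(expn0 p) ltn_exp2l ?prime_gt1.
move: chi_le ql q_gt1 => /leP/le_INR; rewrite -!multE -plusE plus_INR !mult_INR.
move: (INR (expn p k)) (INR (chiG F)) => q c chi_le ql q_gt1.
have lnq_gt0 : 0 < ln q by rewrite -ln_1; apply: ln_increasing; lra.
have lnq_le : ln q <= INR l.
  rewrite -[INR l]ln_exp; apply/Rlt_le/ln_increasing; first lra.
  by have := INR_exp2_le l; lra.
have C_ge0 := pos_INR C.
have c_le : (c - 2 * q) * INR l <= INR C * q.
  by move: chi_le; rewrite /=; lra.
have : (c - 2 * q) * ln q <= (INR C + 1) * q.
  (* Replacing [INR l] by the smaller [ln q] needs a nonnegative excess $c - 2q$; a negative one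
     satisfies the bound at once. *)
  have [cq|cq] := Rle_lt_dec 0 (c - 2 * q); last by nra.
  by have := Rmult_le_compat_l _ _ _ cq lnq_le; lra.
move=> /(Rmult_le_compat_r (/ ln q)) H.
have := H (Rlt_le _ _ (Rinv_0_lt_compat _ lnq_gt0)).
rewrite Rmult_assoc Rinv_r; last lra.
by rewrite /Rdiv; lra.
Qed.
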